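(* Let $D:\mathbb{R}^n\to(0,\infty)$ be a differentiable decision function, with the continuous action space under the Euclidean ($L_2$) norm described in the context, and suppose $\nabla D(x)\neq 0$ for every $x\in\mathbb{R}^n$. Then the gradient-following policy is optimal for $D$ if and only if all gradients of $D$ point in the same direction $\vec c$ and have equal magnitude on each hyperplane orthogonal to $\vec c$; that is, if and only if there is a unit vector $\vec c\in\mathbb{R}^n$ such that $\nabla D(x)=\|\nabla D(x)\|_2\,\vec c$ for all $x\in\mathbb{R}^n$ and $\|\nabla D(x)\|_2=\|\nabla D(y)\|_2$ whenever $\vec c\cdot(x-y)=0$.
   Context: The state of an individual is $(x,r)$, where $x\in\mathbb{R}^n$ is the feature vector and $r\ge 0$ is the remaining available displacement (resources). Every coordinate of $x$ can be manipulated independently: the individual can move $x$ in any direction, and the cost of a movement is its Euclidean length, so from $(x_0,r)$ the set of reachable final feature vectors is the closed ball $\{x:\|x-x_0\|_2\le r\}$ (the individual may stop early). The individual wants to maximize the value of $D$ at the final feature vector. The gradient-following policy is: at each point take an infinitesimal step in the direction of $\nabla D$. When $\nabla D$ vanishes nowhere, a gradient-following trajectory from $x_0$ with budget $r$ is a continuous curve $\gamma:[0,r]\to\mathbb{R}^n$ with $\gamma(0)=x_0$ and $\gamma'(t)=\nabla D(\gamma(t))/\|\nabla D(\gamma(t))\|_2$ for all $t\in[0,r)$ (one-sided at $t=0$). Its final point is $\gamma(r)$. The policy is optimal for $D$ if, for every $x_0\in\mathbb{R}^n$ and every $r\ge0$, following it from $x_0$ with budget $r$ ends at a best reachable point: a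 gradient-following trajectory from $x_0$ with budget $r$ exists, and each such trajectory $\gamma$ satisfies $D(\gamma(r))=\max_{\|x-x_0\|_2\le r}D(x)$. *)

(* Defs.v *)
From mathcomp Require Import all_boot all_order all_algebra.
From mathcomp Require Import all_classical all_reals all_analysis.

Set Implicit Arguments.
Unset Strict Implicit.
Unset Printing Implicit Defensive.

Import Order.TTheory GRing.Theory Num.Theory.
Import numFieldNormedType.Exports.

Local Open Scope classical_set_scope.
Local Open Scope ring_scope.

Definition dotv (R : realType) (n : nat) (u v : 'rV[R]_n) : R :=
  \sum_(i < n) u 0 i * v 0 i.

(* The library norm `|_| on 'rV[R]_n is the sup norm, hence a separate
   Euclidean norm; both induce the same topology and differentials. *)
Definition l2norm (R : realType) (n : nat) (u : 'rV[R]_n) : R :=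
  Num.sqrt (dotv u u).

Definition gradient (R : realType) (n : nat) (D : 'rV[R]_n -> R)
    (x : 'rV[R]_n) : 'rV[R]_n :=
  \row_(i < n) 'D_(delta_mx 0 i) D x.

Definition reachable (R : realType) (n : nat) (x0 : 'rV[R]_n) (r : R) :
    set 'rV[R]_n :=
  [set x | l2norm (x - x0) <= r].

Definition is_maximum (R : realType) (A : set R) (m : R) : Prop :=
  A m /\ ubound A m.

Definition unit_gradient (R : realType) (n : nat) (D : 'rV[R]_n -> R)
    (x : 'rV[R]_n) : 'rV[R]_n :=
  (l2norm (gradient D x))^-1 *: gradient D x.

(* Only the values of gamma on [0, r] matter: the derivative at 0 is the right
   derivative, and nothing is required of the derivative at r. *)
Definition gradient_trajectory (R : realType) (n : nat) (D : 'rV[R]_n -> R)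
    (x0 : 'rV[R]_n) (r : R) (gamma : R -> 'rV[R]_n) : Prop :=
  [/\ {within `[0, r], continuous gamma},
      gamma 0 = x0,
      0 < r ->
        h^-1 *: (gamma h - gamma 0) @[h --> 0^'+] --> unit_gradient D (gamma 0)
    & forall t : R, 0 < t < r ->
        is_derive t 1 gamma (unit_gradient D (gamma t))].

Definition gradient_policy_optimal (R : realType) (n : nat)
    (D : 'rV[R]_n -> R) : Prop :=
  forall (x0 : 'rV[R]_n) (r : R), 0 <= r ->
    (exists gamma : R -> 'rV[R]_n, gradient_trajectory D x0 r gamma) /\
    (forall gamma : R -> 'rV[R]_n, gradient_trajectory D x0 r gamma ->
       is_maximum [set D x | x in reachable x0 r] (D (gamma r))).

(* Main.v *)
(* Unit-speed trajectories are 1-Lipschitz and a maximum over a ball cannot be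
   interior (the gradient does not vanish), so an optimal trajectory is the
   straight ray from x in the direction u(x) of the gradient; hence u is constant
   on that ray and D is maximal over B(x, r) at x + r u(x).  A minimum y of D over
   B(x, r) satisfies x = y + r u(y), so u is also constant on the backward ray.
   Letting the centers of balls recede along the backward ray,
   D(z) <= D(x + (u(x).(z - x)) u(x)) for all z.  Applying this to two points x, y
   and composing, with k = u(x).u(y), gives D(y + t u(y)) <= D(y + (c + t k^2) u(y))
   for all t; as D increases strictly along that line, k^2 = 1, and k = -1 would
   make D both increase and decrease.  So u is constant, and the half-space
   inequality makes D constant on the hyperplanes orthogonal to u. *)
Require Import Defs.
From mathcomp Require Import all_boot all_order all_algebra.
From mathcomp Require Import all_classical all_reals all_analysis.
From mathcomp Require Import ring lra.
Import Order.TTheory GRing.Theory Num.Theory.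
Import numFieldNormedType.Exports.
Local Open Scope classical_set_scope.
Local Open Scope ring_scope.

(** * Euclidean inner product and norm on row vectors *)

Section Dot.
Context {R : realType} {n : nat}.
Implicit Types (u v w : 'rV[R]_n) (k : R).

Lemma dotvC u v : dotv u v = dotv v u.
Proof. by apply: eq_bigr => i _; rewrite mulrC. Qed.

Lemma dotvDl u v w : dotv (u + v) w = dotv u w + dotv v w.
Proof. by rewrite -big_split; apply: eq_bigr => i _; rewrite mxE mulrDl. Qed.

Lemma dotvZl k u v : dotv (k *: u) v = k * dotv u v.
Proof. by rewrite mulr_sumr; apply: eq_bigr => i _; rewrite mxE mulrA. Qed.

Lemma dotvDr u v w : dotv w (u + v) = dotv w u + dotv w v.
Proof. by rewrite !(dotvC w) dotvDl. Qed.

Lemma dotvZr k u v : dotv u (k *: v) = k * dotv u v.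
Proof. by rewrite !(dotvC u) dotvZl. Qed.

Lemma dotvNl u v : dotv (- u) v = - dotv u v.
Proof. by rewrite -scaleN1r dotvZl mulN1r. Qed.

Lemma dotvNr u v : dotv u (- v) = - dotv u v.
Proof. by rewrite -scaleN1r dotvZr mulN1r. Qed.

Definition dotvE := (dotvDl, dotvDr, dotvNl, dotvNr, dotvZl, dotvZr).

Lemma dotvv_ge0 u : 0 <= dotv u u.
Proof. by apply: sumr_ge0 => i _; rewrite -expr2 sqr_ge0. Qed.

Lemma dotvv_eq0 u : dotv u u = 0 -> u = 0.
Proof.
move=> /eqP; rewrite psumr_eq0 => [/allP u0|i _]; last by rewrite -expr2 sqr_ge0.
apply/rowP => i; rewrite mxE; apply/eqP.
by have := u0 i (mem_index_enum _); rewrite -expr2 sqrf_eq0.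
Qed.

Lemma l2norm_ge0 u : 0 <= l2norm u.
Proof. exact: sqrtr_ge0. Qed.

Lemma sqr_l2norm u : l2norm u ^+ 2 = dotv u u.
Proof. by rewrite sqr_sqrtr // dotvv_ge0. Qed.

Lemma l2norm_eq0 u : l2norm u = 0 -> u = 0.
Proof. by move=> u0; apply: dotvv_eq0; rewrite -sqr_l2norm u0 expr0n. Qed.

Lemma l2norm_gt0 u : u <> 0 -> 0 < l2norm u.
Proof.
move=> u0; rewrite lt_neqAle l2norm_ge0 andbT eq_sym.
by apply/eqP => /l2norm_eq0.
Qed.

Lemma l2normZ k u : l2norm (k *: u) = `|k| * l2norm u.
Proof.
by rewrite /l2norm !dotvE mulrA -expr2 sqrtrM ?sqr_ge0// sqrtr_sqr.
Qed.

Lemma l2norm1_dotvv {u} : l2norm u = 1 -> dotv u u = 1.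
Proof. by rewrite -sqr_l2norm => ->; rewrite expr1n. Qed.

(** The vector [(v.v) u - (u.v) v] has squared norm [(v.v) ((u.u) (v.v) - (u.v)^2)], which is
    nonnegative. *)
Lemma cauchy_schwarz u v : dotv u v <= l2norm u * l2norm v.
Proof.
have [->|/eqP/l2norm_gt0 v0] := eqVneq v 0.
  by rewrite -(scale0r 0) dotvZr mul0r mulr_ge0 ?l2norm_ge0.
have v2 : 0 < dotv v v by rewrite -sqr_l2norm exprn_gt0.
have := dotvv_ge0 (dotv v v *: u - dotv u v *: v).
rewrite !dotvE (dotvC v u) => h.
have {}h : 0 <= dotv v v * (dotv u u * dotv v v - dotv u v ^+ 2) by nra.
rewrite pmulr_rge0// subr_ge0 in h.
apply: le_trans (ler_norm _) _.
rewrite -ler_sqr ?nnegrE ?mulr_ge0 ?l2norm_ge0//.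
by rewrite real_normK ?num_real// exprMn !sqr_l2norm.
Qed.

Lemma l2normD u v : l2norm (u + v) <= l2norm u + l2norm v.
Proof.
rewrite -ler_sqr ?nnegrE ?addr_ge0 ?l2norm_ge0// sqrrD !sqr_l2norm !dotvE.
by rewrite (dotvC v u); have := cauchy_schwarz u v; lra.
Qed.

Lemma dotv_continuous w u : dotv w v @[v --> u] --> dotv w u.
Proof.
have -> : dotv w = \sum_(i < n) (fun v : 'rV[R]_n => w 0 i * v 0 i).
  by apply/funext => v; rewrite fct_sumE.
apply: (big_ind (fun f : 'rV[R]_n -> R => f v @[v --> u] --> f u)).
- exact: (@cvg_cst R 0 _ (nbhs u)).
- by move=> f g cf cg; exact: (@cvgD _ R^o _ (nbhs u) _ f g _ _ cf cg).
- move=> i _; apply: (@cvgM _ _ (nbhs u)); last exact: coord_continuous.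
  exact: (@cvg_cst R _ _ (nbhs u)).
Qed.

End Dot.

(** * Derivatives along curves and lines in terms of the gradient *)

Section Derive.
Context {R : realType}.

Lemma is_derive_cvg {V W : normedModType R} {f : V -> W} {a v : V} {l : W} :
  is_derive a v f l <->
  h^-1 *: (f (h *: v + a) - f a) @[h --> (0 : R)^'] --> l.
Proof.
split=> [[df <-] //|fl].
by split; [apply/cvg_ex; exists l|exact: cvg_lim fl].
Qed.

Context {n : nat}.

Lemma is_derive_dotv {w : 'rV[R]_n} {g : R -> 'rV[R]_n} {t : R} {v : 'rV[R]_n} :
  is_derive t 1 g v -> is_derive t 1 (dotv w \o g) (dotv w v).
Proof.
move=> /is_derive_cvg gv; apply/is_derive_cvg.
suff <- : dotv w \o (fun h => h^-1 *: (g (h *: 1 + t) - g t)) =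
    (fun h => h^-1 *: ((dotv w \o g) (h *: 1 + t) - (dotv w \o g) t)).
  exact: cvg_comp gv (dotv_continuous w v).
by apply/funext => h /=; rewrite dotvZr dotvDr dotvNr.
Qed.

Lemma deriveE_gradient {D : 'rV[R]_n -> R} {x : 'rV[R]_n} (v : 'rV[R]_n) :
  differentiable D x -> 'D_v D x = dotv (gradient D x) v.
Proof.
move=> dD; rewrite deriveE// [in LHS](row_sum_delta v) linear_sum.
by apply: eq_bigr => i _; rewrite linearZ mxE deriveE//= mulrC.
Qed.

Lemma is_derive_line {D : 'rV[R]_n -> R} {x v : 'rV[R]_n} {s : R} :
  differentiable D (x + s *: v) ->
  is_derive s 1 (fun t => D (x + t *: v)) (dotv (gradient D (x + s *: v)) v).
Proof.
move=> dD; apply/is_derive_cvg; rewrite -(deriveE_gradient v dD).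
have := @diff_derivable _ _ _ _ _ v dD.
rewrite /derivable /derive /=.
suff -> : (fun h => h^-1 *: (D (x + (h *: 1 + s) *: v) - D (x + s *: v))) =
  (fun h => h^-1 *: (D (h *: v + (x + s *: v)) - D (x + s *: v))) by [].
apply/funext => h; do 3 f_equal.
by rewrite scalerDl [h *: 1]mulr1 addrCA.
Qed.

End Derive.

Lemma derive_gt0_incr_right {R : realType} {f : R -> R} {s l : R} :
  is_derive s 1 f l -> 0 < l -> \forall h \near 0^'+, f s < f (h + s).
Proof.
move=> /is_derive_cvg /cvg_dnbhs_at_right fl l0.
near=> h.
have h0 : 0 < h by near: h; exact: nbhs_right_gt.
rewrite -subr_gt0 -(pmulr_rgt0 _ (_ : 0 < h^-1)) ?invr_gt0//.
rewrite -[h in f (h + s)]mulr1.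
by near: h; exact: cvgr_gt fl _ l0.
Unshelve. all: by end_near. Qed.

(** * Directions of ascent and descent, and the mean value theorem on lines *)

Section Differentiable.
Context {R : realType} {n : nat} {D : 'rV[R]_n -> R}.
Hypothesis D_diff : forall x, differentiable D x.

Lemma ascent_direction {x v : 'rV[R]_n} : 0 < dotv (gradient D x) v ->
  \forall h \near 0^'+, D x < D (x + h *: v).
Proof.
move=> dv; have := is_derive_line (D_diff (x + 0 *: v)).
rewrite scale0r addr0 => /derive_gt0_incr_right /(_ dv).
by apply: filterS => h; rewrite scale0r !addr0.
Qed.

Lemma descent_direction {x v : 'rV[R]_n} : dotv (gradient D x) v < 0 ->
  \forall h \near 0^'+, D (x + h *: v) < D x.
Proof.
rewrite -oppr_gt0 => dv; have := is_deriveN (is_derive_line (D_diff (x + 0 *: v))).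
rewrite scale0r addr0 => /derive_gt0_incr_right /(_ dv).
by apply: filterS => h; rewrite /= !fctE ltrN2 scale0r !addr0.
Qed.

Lemma line_MVT (x v : 'rV[R]_n) (a b : R) : a < b ->
  exists2 c, c \in `]a, b[ &
    D (x + b *: v) - D (x + a *: v) = dotv (gradient D (x + c *: v)) v * (b - a).
Proof.
move=> ab.
apply: (@MVT R (fun t => D (x + t *: v)) (fun t => dotv (gradient D (x + t *: v)) v)).
- exact: ab.
- by move=> t _; exact: is_derive_line.
- by apply: derivable_within_continuous => t _; have [] := is_derive_line (D_diff (x + t *: v)).
Qed.

Lemma continuous_line (x v : 'rV[R]_n) : continuous (fun t : R => D (x + t *: v)).
Proof.
move=> t; apply: (@differentiable_continuous _ R^o R^o).
by apply/derivable1_diffP; have [] := is_derive_line (D_diff (x + t *: v)).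
Qed.

End Differentiable.

(** * Speed bounds for gradient trajectories *)

Section Trajectory.
Context {R : realType} {n : nat} {D : 'rV[R]_n -> R}.

Lemma l2norm_unit_gradient (x : 'rV[R]_n) : gradient D x <> 0 ->
  l2norm (unit_gradient D x) = 1.
Proof.
move=> /l2norm_gt0 g0; rewrite l2normZ ger0_norm ?invr_ge0 ?l2norm_ge0//.
by rewrite mulVf// gt_eqF.
Qed.

Lemma gradientE (x : 'rV[R]_n) : gradient D x <> 0 ->
  gradient D x = l2norm (gradient D x) *: unit_gradient D x.
Proof. by move=> /l2norm_gt0 g0; rewrite scalerA divff ?scale1r// gt_eqF. Qed.

(** The mean value theorem fails for vector-valued curves, so it is applied to the scalar function
    [dotv w \o gamma]. *)
Lemma trajectory_increment {x0 : 'rV[R]_n} {r : R} {gamma : R -> 'rV[R]_n}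
    (w : 'rV[R]_n) {s t : R} :
  gradient_trajectory D x0 r gamma -> 0 <= s -> s < t -> t <= r ->
  exists2 xi, xi \in `]s, t[ &
    dotv w (gamma t - gamma s) = dotv w (unit_gradient D (gamma xi)) * (t - s).
Proof.
move=> [cg _ _ dg] s0 st tr.
have [] := @MVT R (dotv w \o gamma) (fun t => dotv w (unit_gradient D (gamma t))) _ _ st.
- move=> xi; rewrite in_itv/= => /andP[sxi xit]; apply: is_derive_dotv; apply: dg.
  by apply/andP; split; [exact: le_lt_trans s0 sxi|exact: lt_le_trans xit tr].
- apply: within_continuous_comp => [u _|]; first exact: dotv_continuous.
  by apply: continuous_subspaceW cg; apply: subset_itv; rewrite bnd_simp.
- by move=> xi xist /= E; exists xi => //; rewrite dotvDr dotvNr.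
Qed.

Hypothesis grad_neq0 : forall x, gradient D x <> 0.

(** With the increment itself as [w], the squared length of the increment is at most its length
    times [t - s]. *)
Lemma trajectory_lipschitz {x0 : 'rV[R]_n} {r : R} {gamma : R -> 'rV[R]_n}
    {s t : R} :
  gradient_trajectory D x0 r gamma -> 0 <= s -> s <= t -> t <= r ->
  l2norm (gamma t - gamma s) <= t - s.
Proof.
move=> tg s0; rewrite le_eqVlt => /predU1P[<- _|st tr].
  by rewrite !subrr -(scale0r 0) l2normZ normr0 mul0r.
have [xi _] := trajectory_increment (gamma t - gamma s) tg s0 st tr.
have := cauchy_schwarz (gamma t - gamma s) (unit_gradient D (gamma xi)).
rewrite l2norm_unit_gradient// mulr1 -sqr_l2norm => cs E.
have := l2norm_ge0 (gamma t - gamma s); rewrite le_eqVlt => /predU1P[<-|N0].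
  by rewrite subr_ge0 ltW.
rewrite -(ler_pM2l N0) -expr2 E ler_wpM2r// subr_ge0 ltW//.
Qed.

End Trajectory.

(** * Velocity of straight lines *)

Section Line.
Context {R : realType} {n : nat}.
Implicit Types x v : 'rV[R]_n.

(** The filter is left general to serve both the two-sided derivative and the right derivative at
    time 0. *)
Lemma cvg_line_slope {F : set_system R} {FF : Filter F} x v t :
  (\forall h \near F, h != 0) ->
  h^-1 *: (x + (h + t) *: v - (x + t *: v)) @[h --> F] --> v.
Proof.
move=> F0; apply: cvg_near_cst; apply: filterS F0 => h h0.
by rewrite opprD addrACA subrr add0r scalerDl addrK scalerA mulVf// scale1r.
Qed.

Lemma is_derive_affine x v (t : R) : is_derive t 1 (fun t : R => x + t *: v) v.
Proof.
apply/is_derive_cvg.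
suff -> : (fun h : R => h^-1 *: (x + (h *: 1 + t) *: v - (x + t *: v))) =
    (fun h : R => h^-1 *: (x + (h + t) *: v - (x + t *: v))).
  by apply: cvg_line_slope; exact: nbhs_dnbhs_neq.
by apply/funext => h; rewrite [h *: 1]mulr1.
Qed.

End Line.

(** * Optimal trajectories are straight *)

Section Optimal.
Context {R : realType} {n : nat} {D : 'rV[R]_n -> R}.
Hypothesis D_diff : forall x, differentiable D x.
Hypothesis grad_neq0 : forall x, gradient D x <> 0.

Lemma gradient_dot_unit (x : 'rV[R]_n) :
  dotv (gradient D x) (unit_gradient D x) = l2norm (gradient D x).
Proof.
rewrite {1}gradientE// dotvZl l2norm1_dotvv ?mulr1//.
exact: l2norm_unit_gradient.
Qed.

Lemma optimal_trajectory_straight {x0 : 'rV[R]_n} {r : R}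
    {gamma : R -> 'rV[R]_n} {t : R} :
  gradient_trajectory D x0 r gamma -> 0 < r ->
  is_maximum [set D x | x in reachable x0 r] (D (gamma r)) ->
  0 <= t <= r -> gamma t = x0 + t *: unit_gradient D x0.
Proof.
move=> tg r0 [_ gmax]; have [_ g0 dg0 _] := tg.
(* An endpoint interior to the ball could be improved by a further small step along the gradient. *)
have Nr : l2norm (gamma r - x0) = r.
  have := trajectory_lipschitz grad_neq0 tg (lexx _) (ltW r0) (lexx r).
  rewrite subr0 g0 le_eqVlt => /predU1P[//|Nr]; exfalso.
  have dv : 0 < dotv (gradient D (gamma r)) (unit_gradient D (gamma r)).
    by rewrite gradient_dot_unit; exact: l2norm_gt0.
  have asc := ascent_direction D_diff dv.
  near (0 : R)^'+ => h.
  have h0 : 0 < h by near: h; exact: nbhs_right_gt.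
  suff : D (gamma r + h *: unit_gradient D (gamma r)) <= D (gamma r).
    by apply/negP; rewrite -ltNge; near: h.
  apply: gmax; eexists; last reflexivity.
  rewrite /reachable/= addrAC; apply: le_trans (l2normD _ _) _.
  rewrite l2normZ l2norm_unit_gradient// mulr1 gtr0_norm//.
  by rewrite -lerBrDl ltW//; near: h; apply: nbhs_right_lt; rewrite subr_gt0.
have [v v1 vr] : exists2 v, l2norm v = 1 & dotv v (gamma r - x0) = r.
  exists (r^-1 *: (gamma r - x0)).
    by rewrite l2normZ Nr gtr0_norm ?invr_gt0// mulVf// gt_eqF.
  by rewrite dotvZl -sqr_l2norm Nr expr2 mulrA mulVf ?mul1r// gt_eqF.
(* Equality case of the triangle inequality: reaching distance [r] with length at most [r] forces
   [s <= v.e] for [e = gamma s - x0], while [|e| <= s]; hence [|e - s v|^2 <= 0]. *)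
have line s : 0 <= s <= r -> gamma s = x0 + s *: v.
  move=> /andP[s0 sr].
  have L1 := trajectory_lipschitz grad_neq0 tg (lexx _) s0 sr.
  have L2 := trajectory_lipschitz grad_neq0 tg s0 sr (lexx _).
  rewrite subr0 g0 in L1.
  have cs := cauchy_schwarz v (gamma r - gamma s).
  rewrite v1 mul1r in cs.
  have vs : s <= dotv v (gamma s - x0).
    have -> : gamma s - x0 = (gamma r - x0) - (gamma r - gamma s).
      by rewrite opprB [RHS]addrC addrA subrK.
    by rewrite dotvDr dotvNr vr; lra.
  have e2 : dotv (gamma s - x0) (gamma s - x0) <= s ^+ 2.
    by rewrite -sqr_l2norm ler_sqr ?nnegrE ?l2norm_ge0.
  apply/eqP; rewrite -subr_eq0 opprD addrA; apply/eqP/dotvv_eq0.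
  apply/eqP; rewrite eq_le dotvv_ge0 andbT.
  move: (gamma s - x0) vs e2 => e vs e2.
  rewrite !dotvE (l2norm1_dotvv v1) (dotvC e v).
  by nra.
(* The right derivative at time 0 identifies [v] with the initial gradient direction. *)
suff -> : unit_gradient D x0 = v by exact: line.
rewrite -g0; refine (cvg_unique _ (dg0 r0) _); first exact: norm_hausdorff.
apply: cvg_near_cst; near=> h.
have h0 : 0 < h by near: h; exact: nbhs_right_gt.
have hr : h <= r by near: h; exact: nbhs_right_ltW.
rewrite !line ?(ltW h0) ?hr ?lexx ?(ltW r0)// scale0r addr0 addrAC subrr add0r.
by rewrite scalerA mulVf ?scale1r// gt_eqF.
Unshelve. all: by end_near. Qed.
End Optimal.

(** * Compactness of Euclidean balls *)

Section Compact.
Context {R : realType} {n : nat}.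

Lemma norm_le_l2norm (v : 'rV[R]_n) : `|v| <= l2norm v.
Proof.
rewrite [leLHS]/Num.Def.normr /= mx_normrE; apply/bigmax_leP; split=> [|[i j] _] /=; first exact: l2norm_ge0.
rewrite -ler_sqr ?nnegrE ?l2norm_ge0// real_normK ?num_real// sqr_l2norm.
rewrite /dotv (bigD1 j)//= ord1 expr2 lerDl.
by apply: sumr_ge0 => k _; rewrite -expr2 sqr_ge0.
Qed.

(* The ball is an intersection of half-spaces, which are closed. *)
Lemma closed_reachable (x : 'rV[R]_n) (r : R) : 0 <= r -> closed (reachable x r).
Proof.
move=> r0.
have -> : reachable x r =
    \bigcap_(w in setT) (dotv w @^-1` [set s | s <= r * l2norm w + dotv w x]).
  apply/seteqP; split=> [z zr w _|z zr] /=.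
    rewrite -lerBlDr -dotvNr -dotvDr mulrC (le_trans (cauchy_schwarz _ _))//.
    by rewrite ler_wpM2l// l2norm_ge0.
  (* The half-space with normal [z - x] gives [|z - x|^2 <= r |z - x|]. *)
  have := zr (z - x) I; rewrite /= -lerBlDr -dotvNr -dotvDr -sqr_l2norm.
  rewrite /reachable/=; have := l2norm_ge0 (z - x).
  by rewrite le_eqVlt => /predU1P[<-//|N0]; rewrite expr2 ler_pM2r.
apply: closed_bigI => w _; apply: closed_comp; last exact: closed_le.
by move=> z _; exact: dotv_continuous.
Qed.

Lemma compact_reachable (x : 'rV[R]_n) (r : R) : 0 <= r -> compact (reachable x r).
Proof.
move=> r0; apply: bounded_closed_compact; last exact: closed_reachable.
exists (r + `|x|); split; first exact: num_real.
move=> M rM z zr; apply: le_trans (ltW rM).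
rewrite -[z in `|z|](subrK x); apply: le_trans (ler_normD _ _) _.
by rewrite lerD2r (le_trans (norm_le_l2norm _)).
Qed.

End Compact.

(** * Consequences of optimality, up to a constant gradient direction *)

Section Optimal.
Context {R : realType} {n : nat} {D : 'rV[R]_n -> R}.
Hypothesis D_diff : forall x, differentiable D x.
Hypothesis grad_neq0 : forall x, gradient D x <> 0.

(** The point [y] is a minimum of [D] over the ball around [x]: it must be the boundary point
    opposite to its own gradient direction. *)
Lemma ball_center_on_gradient_ray (x : 'rV[R]_n) (r : R) : 0 <= r ->
  exists y, x = y + r *: unit_gradient D y.
Proof.
rewrite le_eqVlt => /predU1P[<-|r0]; first by exists x; rewrite scale0r addr0.
have [|||y yr ymin] := @EVT_min_rV R n D (reachable x r).
- by exists x; rewrite /reachable/= subrr -(scale0r 0) l2normZ normr0 mul0r ltW.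
- exact: compact_reachable (ltW r0).
- by apply: continuous_subspaceT => z; exact: differentiable_continuous.
exists y; have {}yr : l2norm (y - x) <= r by rewrite inE in yr.
have g1 : l2norm (unit_gradient D y) = 1 by exact: l2norm_unit_gradient.
have dvE := gradientE _ (grad_neq0 y).
move: (unit_gradient D y) g1 dvE => g g1 dvE.
have yr2 : dotv (y - x) (y - x) <= r ^+ 2.
  by rewrite -sqr_l2norm ler_sqr ?nnegrE ?l2norm_ge0 ?(ltW r0).
(* Moving from [y] towards the point [x - r *: g] of the ball cannot decrease [D]. *)
have gw : r <= dotv g (x - y).
  rewrite leNgt; apply/negP => gr.
  have dv : dotv (gradient D y) (x - r *: g - y) < 0.
    rewrite dvE dotvZl pmulr_rlt0; last exact: l2norm_gt0.
    by rewrite addrAC dotvDr dotvNr dotvZr l2norm1_dotvv//; lra.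
  have desc := descent_direction D_diff dv.
  near (0 : R)^'+ => h.
  have h0 : 0 < h by near: h; exact: nbhs_right_gt.
  have h1 : h <= 1 by near: h; exact: nbhs_right_ltW.
  suff : D y <= D (y + h *: (x - r *: g - y)) by apply/negP; rewrite -ltNge; near: h.
  apply: ymin; rewrite inE /reachable/=.
  (* A convex combination of [y - x] and [- r *: g], both of norm at most [r]. *)
  have -> : y + h *: (x - r *: g - y) - x = (1 - h) *: (y - x) + (- (h * r)) *: g.
    by apply/rowP => i; rewrite !mxE; ring.
  apply: le_trans (l2normD _ _) _; rewrite !l2normZ g1 normrN.
  rewrite !ger0_norm ?subr_ge0 ?mulr_ge0 ?(ltW h0) ?(ltW r0)//; nra.
(* With [e = x - y], the bounds [|e| <= r] and [r <= g.e] give [|e - r g|^2 <= 0]. *)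
rewrite addrC; apply/eqP; rewrite -subr_eq -subr_eq0; apply/eqP/dotvv_eq0/eqP.
rewrite eq_le dotvv_ge0 andbT.
rewrite -[y - x]opprB in yr2; move: (x - y) gw yr2 => e gw yr2.
rewrite !dotvE in yr2 *; rewrite (l2norm1_dotvv g1) (dotvC e g).
by nra.
Unshelve. all: by end_near. Qed.

Hypothesis opt : gradient_policy_optimal D.

Lemma optimal_ball_max (x z : 'rV[R]_n) (r : R) : 0 <= r ->
  l2norm (z - x) <= r -> D z <= D (x + r *: unit_gradient D x).
Proof.
rewrite le_eqVlt => /predU1P[<- zx|r0 zx].
  suff -> : z = x by rewrite scale0r addr0.
  by apply/eqP; rewrite -subr_eq0; apply/eqP/l2norm_eq0/eqP; rewrite eq_le zx l2norm_ge0.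
have [[gamma tg] /(_ _ tg) gmax] := opt x r (ltW r0).
rewrite -(optimal_trajectory_straight D_diff grad_neq0 tg r0 gmax); last by rewrite lexx ltW.
by have [_] := gmax; apply; exists z.
Qed.

Lemma unit_gradient_ray (x : 'rV[R]_n) (r : R) : 0 <= r ->
  unit_gradient D (x + r *: unit_gradient D x) = unit_gradient D x.
Proof.
rewrite le_eqVlt => /predU1P[<-|r0]; first by rewrite scale0r addr0.
(* The budget exceeds [r] so that time [r] is interior and the trajectory has a two-sided derivative
   there. *)
have r1 : 0 < r + 1 by rewrite addr_gt0.
have [[gamma tg] /(_ _ tg) gmax] := opt x (r + 1) (ltW r1).
have line s : 0 <= s <= r + 1 -> gamma s = x + s *: unit_gradient D x.
  exact: (optimal_trajectory_straight D_diff grad_neq0 tg r1 gmax).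
have r01 : r \in `]0, r + 1[ by rewrite in_itv/= r0 ltrDl ltr01.
have [_ _ _ /(_ r)] := tg; rewrite line; last by rewrite (ltW r0) lerDl ler01.
move=> /(_ r01) dg.
have /near_eq_is_derive/(_ dg) : \near r, gamma r = x + r *: unit_gradient D x.
  near=> s; apply: line.
  have : s \in `]0, r + 1[ by near: s; exact: near_in_itvoo.
  by rewrite in_itv/= => /andP[/ltW -> /ltW ->].
by move=> [_ <-]; have [_] := is_derive_affine x (unit_gradient D x) r.
Unshelve. all: by end_near. Qed.

(** For [s < 0], [x] lies on the forward ray of some [y] at distance [- s]; the two share their
    direction, so [y] is [x + s *: unit_gradient D x]. *)
Lemma unit_gradient_line (x : 'rV[R]_n) (s : R) :
  unit_gradient D (x + s *: unit_gradient D x) = unit_gradient D x.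
Proof.
have [/unit_gradient_ray //|/ltW] := leP 0 s; rewrite -oppr_ge0 => s0.
have [y xE] := ball_center_on_gradient_ray x _ s0.
rewrite [X in _ *: unit_gradient D X]xE [in RHS]xE !unit_gradient_ray//.
by rewrite {1}xE scaleNr subrK.
Qed.

(* Balls through [x + s *: a] whose centers recede to infinity along [- a]
   exhaust the half-space below [x + s *: a]. *)
Lemma optimal_halfspace_max (x z : 'rV[R]_n) :
  D z <= D (x + dotv (unit_gradient D x) (z - x) *: unit_gradient D x).
Proof.
have a1 := l2norm1_dotvv (l2norm_unit_gradient _ (grad_neq0 x)).
have a_line := unit_gradient_line x.
move: (unit_gradient D x) a1 a_line => a a1 a_line; set s := dotv a (z - x).
rewrite leNgt; apply/negP => Dz.
have := cvgr_lt _ (continuous_line D_diff x a s) _ Dz.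
move=> [e /= e0 near_s].
pose q := dotv (z - x - s *: a) (z - x - s *: a).
have q0 : 0 <= q by exact: dotvv_ge0.
(* The center lies at distance [tau] behind [x + s *: a]. This choice makes [(tau + e)^2] exceed
   [q + tau^2], the squared distance from the center to [z]. *)
have [tau tau0 tauE] : exists2 tau, 0 < tau & tau * e = q + e.
  exists (q / e + 1); first by rewrite ltr_wpDl// divr_ge0// ltW.
  by rewrite mulrDl mul1r divfK// gt_eqF.
pose N := l2norm (z - (x + (s - tau) *: a)).
have N2 : N ^+ 2 = q + tau ^+ 2.
  have -> : N ^+ 2 = dotv (z - (x + (s - tau) *: a)) (z - (x + (s - tau) *: a)).
    exact: sqr_l2norm.
  have -> : z - (x + (s - tau) *: a) = (z - x - s *: a) + tau *: a.
    by apply/rowP => i; rewrite !mxE; ring.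
  have : dotv (z - x - s *: a) a = 0.
    by rewrite (dotvC _ a) dotvDr dotvNr dotvZr a1 -/s mulr1 subrr.
  rewrite /q; move: (z - x - s *: a) => e' e'a.
  by rewrite !dotvE a1 (dotvC a) e'a; ring.
have N0 : 0 <= N by exact: l2norm_ge0.
have tauN : tau <= N by rewrite -ler_sqr ?nnegrE ?(ltW tau0)// N2 lerDr.
have Ntau : N < tau + e.
  have te0 : 0 <= tau + e by exact: addr_ge0 (ltW tau0) (ltW e0).
  rewrite -ltr_sqr ?nnegrE// N2 sqrrD tauE.
  by have := exprn_gt0 2 e0; lra.
(* The maximum over the ball of radius [N] is attained at parameter [s - tau + N], within [e] of
   [s], where [D] is still below [D z]. *)
have := optimal_ball_max _ _ _ N0 (lexx N).
rewrite a_line -addrA -scalerDl leNgt => /negP; apply.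
apply: near_s => /=; rewrite distrC.
have -> : s - tau + N - s = N - tau by ring.
by rewrite ger0_norm ?subr_ge0// ltrBlDl.
Qed.

Lemma unit_gradient_line_incr (x : 'rV[R]_n) (s t : R) : s < t ->
  D (x + s *: unit_gradient D x) < D (x + t *: unit_gradient D x).
Proof.
move=> st; have [c _ E] := line_MVT D_diff x (unit_gradient D x) s t st.
rewrite -subr_gt0 E mulr_gt0 ?subr_gt0// -{2}(unit_gradient_line x c).
by rewrite gradient_dot_unit//; exact: l2norm_gt0.
Qed.

Lemma unit_gradient_constant (x y : 'rV[R]_n) :
  unit_gradient D x = unit_gradient D y.
Proof.
have a1 := l2norm_unit_gradient _ (grad_neq0 x).
have b1 := l2norm_unit_gradient _ (grad_neq0 y).
have fg s := optimal_halfspace_max y (x + s *: unit_gradient D x).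
have gf t := optimal_halfspace_max x (y + t *: unit_gradient D y).
have f_incr := unit_gradient_line_incr x.
have g_incr := unit_gradient_line_incr y.
move: (unit_gradient D x) (unit_gradient D y) a1 b1 fg gf f_incr g_incr.
move=> a b /l2norm1_dotvv a1 /l2norm1_dotvv b1 fg gf f_incr g_incr.
set k := dotv a b.
pose al := dotv a (y - x); pose be := dotv b (x - y).
have {}fg s : D (x + s *: a) <= D (y + (be + s * k) *: b).
  have := fg s; suff -> : dotv b (x + s *: a - y) = be + s * k by [].
  by rewrite addrAC dotvDr dotvZr (dotvC b a).
have {}gf t : D (y + t *: b) <= D (x + (al + t * k) *: a).
  have := gf t; suff -> : dotv a (y + t *: b - x) = al + t * k by [].
  by rewrite addrAC dotvDr dotvZr.
(* Composing [gf] and [fg] returns to the line through [y], on which [D] is strictly increasing. *)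
have kk t : t <= be + (al + t * k) * k.
  rewrite leNgt; apply/negP => /g_incr; apply/negP; rewrite -leNgt.
  exact: le_trans (gf t) (fg _).
have k2 : k ^+ 2 = 1.
  set c := be + al * k.
  have kt t : 0 <= c + t * (k ^+ 2 - 1) by have := kk t; rewrite /c; nra.
  apply/eqP; rewrite -subr_eq0; apply/negPn/negP => k0.
  (* A nonzero slope would let the affine function in [kt] take the value -1. *)
  have := kt (- (c + 1) / (k ^+ 2 - 1)); rewrite divfK//; lra.
have [k1|kN] : k = 1 \/ k = -1.
  by move/eqP: k2; rewrite sqrf_eq1 => /orP[]/eqP; [left|right].
- apply/eqP; rewrite -subr_eq0; apply/eqP/dotvv_eq0.
  by rewrite !dotvE (dotvC b a) -/k a1 b1 k1; ring.
(* For [k = -1]: [D (x + a) <= D (y + (be - 1) b) <= D (y + be b) <= D (x + (al - be) a) <= D x],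
   since [kk 0] gives [al <= be]. *)
- have := f_incr 0 1 ltr01; rewrite ltNge => /negP[].
  apply: (le_trans (fg 1)); apply: (@le_trans _ _ (D (y + be *: b))).
    by apply/ltW/g_incr; rewrite kN; lra.
  apply: (le_trans (gf be)); have : al + be * k <= 0.
    by have := kk 0; rewrite kN; lra.
  by rewrite le_eqVlt => /predU1P[->//|/f_incr/ltW].
Qed.

End Optimal.

(** * Parallel gradients make the policy optimal *)

Section ParallelGradients.
Context {R : realType} {n : nat} {D : 'rV[R]_n -> R} {c : 'rV[R]_n}.
Hypothesis D_diff : forall x, differentiable D x.
Hypothesis c1 : l2norm c = 1.
Hypothesis gradE : forall x, gradient D x = l2norm (gradient D x) *: c.

Lemma parallel_gradient_le (x y : 'rV[R]_n) : 0 <= dotv c (y - x) -> D x <= D y.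
Proof.
move=> cxy; have [s _] := line_MVT D_diff x (y - x) 0 1 ltr01.
rewrite scale0r scale1r addr0 (addrC x) subrK subr0 mulr1 -[D x <= _]subr_ge0 => ->.
by rewrite gradE dotvZl mulr_ge0// l2norm_ge0.
Qed.

Hypothesis grad_neq0 : forall x, gradient D x <> 0.

Lemma parallel_unit_gradient (x : 'rV[R]_n) : unit_gradient D x = c.
Proof.
rewrite /unit_gradient {2}gradE scalerA mulVf ?scale1r// gt_eqF//.
exact: l2norm_gt0.
Qed.

(** The ray along [c] is a trajectory. Every trajectory ends where [c.(x - x0) = r], the largest
    value over the ball, and [D] is monotone in [c.x]. *)
Lemma parallel_gradient_optimal : gradient_policy_optimal D.
Proof.
move=> x0 r r0; split.
  exists (fun t => x0 + t *: c); split.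
  - by apply: derivable_within_continuous => t _; have [] := is_derive_affine x0 c t.
  - by rewrite scale0r addr0.
  - move=> _; rewrite parallel_unit_gradient.
    suff -> : (fun h : R => h^-1 *: (x0 + h *: c - (x0 + 0 *: c))) =
        (fun h : R => h^-1 *: (x0 + (h + 0) *: c - (x0 + 0 *: c))).
      by apply: cvg_line_slope; near=> h; rewrite gt_eqF//; near: h; exact: nbhs_right_gt.
    by apply/funext => h; rewrite addr0.
  - by move=> t _; rewrite parallel_unit_gradient; exact: is_derive_affine.
move=> gamma tg; have [_ g0 _ _] := tg.
have lip := trajectory_lipschitz grad_neq0 tg (lexx _) r0 (lexx _).
rewrite subr0 g0 in lip.
have crr : dotv c (gamma r - x0) = r.
  have [r0'|] := ltP 0 r; last first.
    move=> r0'; have -> : r = 0 by apply/eqP; rewrite eq_le r0 r0'.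
    by rewrite g0 subrr -(scale0r 0) dotvZr mul0r.
  have [xi _] := trajectory_increment c tg (lexx _) r0' (lexx _).
  by rewrite g0 subr0 parallel_unit_gradient (l2norm1_dotvv c1) mul1r.
split; first by exists (gamma r).
move=> _ [z zr <-]; apply: parallel_gradient_le.
have := cauchy_schwarz c (z - x0); rewrite c1 mul1r => cz.
have -> : gamma r - z = (gamma r - x0) - (z - x0) by rewrite opprB addrA subrK.
by rewrite dotvDr dotvNr crr subr_ge0; exact: le_trans cz zr.
Unshelve. all: by end_near. Qed.

End ParallelGradients.

(** * The equivalence, with equal magnitudes obtained by differentiating along parallel lines *)

Theorem corollary2p1 (R : realType) (n : nat) (D : 'rV[R]_n -> R)
    (D_pos : forall x : 'rV[R]_n, 0 < D x)
    (D_diff : forall x : 'rV[R]_n, differentiable D x)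
    (grad_neq0 : forall x : 'rV[R]_n, gradient D x <> 0) :
  gradient_policy_optimal D <->
  exists c : 'rV[R]_n,
    [/\ l2norm c = 1,
        forall x : 'rV[R]_n, gradient D x = l2norm (gradient D x) *: c
      & forall x y : 'rV[R]_n, dotv c (x - y) = 0 ->
          l2norm (gradient D x) = l2norm (gradient D y)].
Proof.
split=> [opt|[c [c1 gradE _]]]; last exact: (parallel_gradient_optimal D_diff c1).
have uE := unit_gradient_constant D_diff grad_neq0 opt.
exists (unit_gradient D 0); split=> [|x|x y cxy].
- exact: l2norm_unit_gradient.
- by rewrite (uE 0 x); exact: gradientE.
have le_hyperplane (z w : 'rV[R]_n) : dotv (unit_gradient D 0) (z - w) = 0 -> D z <= D w.
  move=> zw; have := optimal_halfspace_max D_diff grad_neq0 opt w z.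
  by rewrite (uE w 0) zw scale0r addr0.
(* Corresponding points of the two lines lie on a common hyperplane orthogonal to the direction, so
   the restrictions of [D] coincide; their derivatives at 0 are the two gradient norms. *)
have line_eq : (fun t : R => D (x + t *: unit_gradient D 0)) =
    (fun t : R => D (y + t *: unit_gradient D 0)).
  apply/funext => t; apply/eqP.
  by rewrite eq_le !le_hyperplane// opprD addrACA subrr addr0// -opprB dotvNr cxy oppr0.
have := is_derive_line (D_diff (y + 0 *: unit_gradient D 0)); rewrite -line_eq.
have := is_derive_line (D_diff (x + 0 *: unit_gradient D 0)).
rewrite !scale0r !addr0 {2}(uE 0 x) {3}(uE 0 y) => -[_ dx] [_ dy].
move: dx dy.
rewrite !gradient_dot_unit//.
by move=> <- <-.
Qed.
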